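(* Let $k\geq 1$ and $n\geq 4k+2$ be integers, and put $a=\lceil n/2\rceil$, $b=\lfloor n/2\rfloor$. If $G$ is a triangle-free graph of order $n$ such that $\kappa(\overline{G})\geq k$, then $$\rho(G)\leq \rho(B_{n,k}),$$ where $$\rho(B_{n,k})^2=\frac{ab-2k+1+\sqrt{(ab-2k+1)^2-4(a-k)(b-k)}}{2}.$$ Equality holds in $\rho(G)\leq\rho(B_{n,k})$ if and only if $G\cong B_{n,k}$.
   Context: All graphs are finite, simple and undirected. $\rho(G)$ denotes the largest eigenvalue of the adjacency matrix of $G$, and $\overline{G}$ is the complement of $G$. The vertex-connectivity $\kappa(H)$ is the minimum number of vertices whose deletion disconnects $H$ or leaves a single vertex; in particular $\kappa(K_n)=n-1$. For $n\geq 2k$, $B_{n,k}$ is the graph obtained from the complete bipartite graph $K_{\lceil n/2\rceil,\lfloor n/2\rfloor}$ by deleting the edges of a matching of size $k$ (up to isomorphism, independent of the matching chosen). *)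

(* Defs.v *)
From mathcomp Require Import all_boot all_order all_algebra.
From mathcomp Require Import polyrcf complex boolp classical_sets reals.

Set Implicit Arguments.
Unset Strict Implicit.
Unset Printing Implicit Defensive.

Import Order.TTheory GRing.Theory Num.Theory.

Local Open Scope ring_scope.

Record sgraph (T : finType) := SGraph {
  adj :> rel T;
  adj_sym : symmetric adj;
  adj_irr : irreflexive adj
}.

Section Graphs.
Variable T : finType.
Implicit Type G : sgraph T.

Definition compl_rel G : rel T := fun x y => (x != y) && ~~ G x y.

Lemma compl_rel_sym G : symmetric (compl_rel G).
Proof. by move=> x y; rewrite /compl_rel eq_sym adj_sym. Qed.

Lemma compl_rel_irr G : irreflexive (compl_rel G).
Proof. by move=> x; rewrite /compl_rel eqxx. Qed.

Definition compl G : sgraph T :=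
  SGraph (compl_rel_sym G) (compl_rel_irr G).

Definition triangle_free G : Prop :=
  forall x y z : T, ~~ [&& G x y, G y z & G x z].

Definition del_rel G (S : {set T}) : rel T :=
  fun x y => [&& x \notin S, y \notin S & G x y].

Definition disconnects G (S : {set T}) : bool :=
  [exists x in ~: S, exists y in ~: S, ~~ connect (del_rel G S) x y].

(* If T is nonempty, deleting all vertices but one leaves a single vertex, so
   the minimum ranges over a nonempty family of sets of size < #|T|, and the
   default value #|T| plays no role. *)
Definition vconn G : nat :=
  \big[minn/#|T|]_(S : {set T} | disconnects G S || (#|~: S| == 1%N)) #|S|.

Definition adjmx (R : realType) G : 'M[R]_#|T| :=
  \matrix_(i, j) (G (enum_val i) (enum_val j))%:R.

(* The supremum is a maximum as soon as T is nonempty: see rho_eigenvalue and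
   le_rho below. *)
Definition rho (R : realType) G : R :=
  sup [set a : R | eigenvalue (adjmx R G) a]%classic.

End Graphs.

Definition isomorphic (T U : finType) (G : sgraph T) (H : sgraph U) : Prop :=
  exists2 f : T -> U, bijective f & forall x y, H (f x) (f y) = G x y.

(* The sides of K_{ceil(n/2), floor(n/2)} are 'I_(uphalf n) and 'I_n./2; the
   deleted matching is { {inl i, inr i} : i < k }, of size k if 2k <= n. *)
Section Bgraph.
Variables n k : nat.

Definition B_vertex : finType := ('I_(uphalf n) + 'I_n./2)%type.

Definition B_rel : rel B_vertex := fun x y =>
  match x, y with
  | inl i, inr j | inr j, inl i => ~~ ((i == j :> nat) && (i < k)%N)
  | _, _ => false
  end.

Lemma B_rel_sym : symmetric B_rel.
Proof. by case=> i [] j. Qed.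

Lemma B_rel_irr : irreflexive B_rel.
Proof. by case. Qed.

Definition Bgraph : sgraph B_vertex := SGraph B_rel_sym B_rel_irr.

End Bgraph.

Section RhoMax.
Variables (R : realType) (T : finType) (G : sgraph T).

Lemma adjmx_has_eigenvalue :
  (0 < #|T|)%N -> exists a : R, eigenvalue (adjmx R G) a.
Proof.
move=> T0; set A := adjmx R G.
pose Ac := map_mx (real_complex R) A.
have [a ea] := eigenvalue_closed Ac T0.
suff ra : a \is Num.real.
  have [b ab] : exists b : R, a = real_complex R b.
    by move: ra => /complex_realP.
  by exists b; move: ea; rewrite ab eigenvalue_map.
move: ea => /eigenvalueP[v vA v0].
pose w := map_mx Num.conj v.
have wA : w *m Ac = Num.conj a *: w.
  rewrite /w -map_mxZ -vA map_mxM; congr (_ *m _).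
  by apply/matrixP=> i j; rewrite !mxE !rmorph_nat.
have AT : Ac^T = Ac.
  by apply/matrixP=> i j; rewrite !mxE adj_sym.
have e : a *: (v *m w^T) = Num.conj a *: (v *m w^T).
  by rewrite scalemxAl -vA -mulmxA -{1}AT -trmx_mul wA linearZ -scalemxAr.
have n0 : (v *m w^T) 0 0 != 0.
  apply: contraNneq v0; rewrite mxE => s0.
  apply/eqP/rowP=> i; rewrite mxE.
  have p j : true -> 0 <= v 0 j * w^T j 0.
    by move=> _; rewrite !mxE mul_conjC_ge0.
  move: s0 => /(psumr_eq0P p)/(_ i isT)/eqP.
  by rewrite !mxE mul_conjC_eq0 => /eqP.
have := congr1 (fun M : 'M_1 => M 0 0) e.
by rewrite [LHS]mxE [RHS]mxE => /(mulIf n0) h; apply/CrealP.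
Qed.

Lemma eigenvalue_rootsR (a : R) :
  eigenvalue (adjmx R G) a = (a \in rootsR (char_poly (adjmx R G))).
Proof.
by rewrite eigenvalue_root_char -roots_on_rootsR ?monic_neq0 ?char_poly_monic //.
Qed.

Lemma adjmx_has_ubound :
  has_ubound [set a : R | eigenvalue (adjmx R G) a]%classic.
Proof.
exists (\sum_(x <- rootsR (char_poly (adjmx R G))) `|x|) => a /=.
rewrite eigenvalue_rootsR => ar; rewrite (big_rem a) //=.
by rewrite (le_trans (ler_norm a)) // lerDl sumr_ge0.
Qed.

Lemma le_rho (a : R) : eigenvalue (adjmx R G) a -> a <= rho R G.
Proof. by move=> ea; apply: ub_le_sup => //; exact: adjmx_has_ubound. Qed.

Lemma rho_eigenvalue : (0 < #|T|)%N -> eigenvalue (adjmx R G) (rho R G).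
Proof.
move=> /adjmx_has_eigenvalue[a0 ea0].
pose s := rootsR (char_poly (adjmx R G)).
pose m := \big[Num.max/a0]_(x <- s) x.
have em : eigenvalue (adjmx R G) m.
  rewrite /m big_seq; elim/big_ind: _ => // [x y ex ey|x].
    by rewrite /Num.max; case: ifP.
  by rewrite /s -eigenvalue_rootsR.
suff -> : rho R G = m by [].
apply/le_anti; rewrite le_rho // andbT; apply: ge_sup; first by exists a0.
move=> x /=; rewrite eigenvalue_rootsR => xs.
exact: (le_bigmax_seq a0 x xpredT id xs isT).
Qed.

End RhoMax.

(* Main.v *)
(* Let x = rho(B_{n,k})^2, the larger root of X^2 - (ab-2k+1) X + (a-k)(b-k);
   one checks x > ab - 2k. Let u be a vertex where the modulus of an
   eigenvector for l is maximal and put A = N(u). Counting walks of length 2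
   from u gives l^2 <= e(A, V \ A), as A is independent. If V \ A contains an
   edge yz, then y and z have no common neighbour, so
   l^2 <= |A| (|V \ A| - 1) <= ab - 2k < x. Otherwise G is bipartite with parts
   A and V \ A; if one of them has at most k vertices, then
   l^2 <= |A| |V \ A| <= ab - 2k < x again. If not, a vertex cover of size < k
   of the missing edges between the parts would disconnect the complement of G,
   so by Koenig's theorem these edges contain a matching of size k. Hence G is a
   subgraph of K_{p,q} minus a k-matching, for which an explicit positive vector
   w satisfies M w <= sqrt(x) w, the defect on the second part being
   (x - 1)(ab - pq). Pairing w with the modulus of an eigenvector gives
   l <= sqrt(x), and in case of equality forces pq = ab and G to be the whole of
   K_{p,q} minus the matching. *)

Require Import Defs.
From mathcomp Require Import all_boot all_order all_algebra.
From mathcomp Require Import reals.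
From mathcomp Require Import zify ring lra.

Set Implicit Arguments.
Unset Strict Implicit.
Unset Printing Implicit Defensive.

Import Order.TTheory GRing.Theory Num.Theory.

Local Open Scope ring_scope.

(** * Eigenvalues as functions on the vertices *)

Section Eigenvalues.
Variables (R : realType) (T : finType) (G : sgraph T).

(** By symmetry of the matrix, the row-vector equation behind [eigenvalue] becomes a sum over
    neighbours. All later arguments use functions on vertices and avoid [enum_rank]. *)
Lemma eigenvalue_adjP (l : R) :
  reflect (exists2 x : T -> R, exists u, x u != 0
             & forall u, \sum_(v | G u v) x v = l * x u)
          (eigenvalue (adjmx R G) l).
Proof.
have mulE (x : 'rV[R]_#|T|) u :
    (x *m adjmx R G) 0 (enum_rank u) = \sum_(v | G u v) x 0 (enum_rank v).
  rewrite mxE [RHS]big_mkcond (reindex (@enum_rank T)) /=; last first.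
    exact: onW_bij (enum_rank_bij T).
  apply: eq_bigr => v _; rewrite mxE !enum_rankK adj_sym.
  by case: (G u v); rewrite ?mulr1 ?mulr0.
apply: (iffP eigenvalueP) => [[x xE x0]|[x [u xu] xE]].
  exists (fun v => x 0 (enum_rank v)) => [|u]; last first.
    by rewrite -mulE xE mxE.
  have /rV0Pn[i xi] := x0.
  by exists (enum_val i); rewrite enum_valK.
exists (\row_i x (enum_val i)).
  apply/rowP => i; rewrite -(enum_valK i) mulE !mxE enum_rankK -xE.
  by apply: eq_bigr => v _; rewrite mxE enum_rankK.
by apply/rV0Pn; exists (enum_rank u); rewrite mxE enum_rankK.
Qed.

Lemma eigenvalue_norm (l : R) (x : T -> R) :
  (forall u, \sum_(v | G u v) x v = l * x u) ->
  forall u, `|l| * `|x u| <= \sum_(v | G u v) `|x v|.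
Proof. by move=> xE u; rewrite -normrM -xE ler_norm_sum. Qed.

(** At a vertex [u] maximising [|x u|], the inequality [eigenvalue_norm] is applied at [u] and then
    at each neighbour, after which every entry is bounded by [|x u|]. *)
Lemma eigenvalue_walk2 (l : R) :
  eigenvalue (adjmx R G) l ->
  exists u, l ^+ 2 <= (\sum_(v | G u v) #|[set w | G v w]|)%:R.
Proof.
case/eigenvalue_adjP => x [u0 xu0] xE.
have [u _ umax] := @Order.TotalTheory.arg_maxP _ _ T u0 xpredT (fun u => `|x u|) isT.
have xu : 0 < `|x u| by rewrite (lt_le_trans _ (umax u0 isT)) ?normr_gt0.
exists u; rewrite -(ler_pM2r xu) -real_normK ?num_real // expr2 -mulrA.
apply: (@le_trans _ _ (`|l| * \sum_(v | G u v) `|x v|)).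
  by rewrite ler_wpM2l // (eigenvalue_norm xE).
rewrite mulr_sumr natr_sum mulr_suml ler_sum // => v _.
apply: le_trans (eigenvalue_norm xE v) _.
apply: (@le_trans _ _ (\sum_(w | G v w) `|x u|)).
  by apply: ler_sum => w _; exact: umax.
by rewrite sumr_const mulr_natl cardsE.
Qed.

(** * Comparison of eigenvalues with a positive supersolution *)

Section Supersolution.
Variables (w : T -> R) (mu : R).
Hypothesis w_gt0 : forall u, 0 < w u.
Hypothesis w_super : forall u, \sum_(v | G u v) w v <= mu * w u.

(* Pairs w with A y - l y and y with mu w - A w, where A is the symmetric
   adjacency matrix. *)
Lemma supersolution_identity (l : R) (y : T -> R) :
  \sum_u w u * (\sum_(v | G u v) y v - l * y u)
    + \sum_u y u * (mu * w u - \sum_(v | G u v) w v)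
  = (mu - l) * \sum_u w u * y u.
Proof.
have swap : \sum_u w u * (\sum_(v | G u v) y v)
          = \sum_u y u * (\sum_(v | G u v) w v).
  under eq_bigr do rewrite mulr_sumr big_mkcond.
  rewrite exchange_big; apply: eq_bigr => u _ /=.
  rewrite mulr_sumr [RHS]big_mkcond; apply: eq_bigr => v _.
  by rewrite adj_sym mulrC.
move/eqP: swap; rewrite -subr_eq0 -sumrB => /eqP swap.
rewrite -[RHS]addr0 -[X in _ = _ + X]swap mulr_sumr -!big_split /=.
by apply: eq_bigr => u _; ring.
Qed.

(** Taking for [y] the modulus of an eigenvector makes both sums of [supersolution_identity]
    nonnegative, while the pairing of [w] with [y] is positive. *)
Lemma le_supersolution (l : R) : eigenvalue (adjmx R G) l -> l <= mu.
Proof.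
case/eigenvalue_adjP => x [u0 xu0] xE.
have wx : 0 < \sum_u w u * `|x u|.
  rewrite (bigD1 u0) //= ltr_pwDl ?mulr_gt0 ?normr_gt0 //.
  by rewrite sumr_ge0 // => u _; rewrite mulr_ge0 // ltW.
rewrite -subr_ge0 -(pmulr_lge0 _ wx) -supersolution_identity.
rewrite addr_ge0 // sumr_ge0 // => u _; rewrite mulr_ge0 ?subr_ge0 //.
  exact: ltW.
apply: le_trans (eigenvalue_norm xE u).
by rewrite ler_wpM2r ?normr_ge0 // ler_norm.
Qed.

(** For [l = mu] the right side of the identity vanishes, hence so does every nonnegative term on
    the left: the modulus is itself an eigenvector, and [w] is tight on its support. *)
Lemma supersolution_eq :
  eigenvalue (adjmx R G) mu ->
  exists y : T -> R, [/\ forall u, 0 <= y u, exists u, 0 < y u,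
    forall u, \sum_(v | G u v) y v = mu * y u
  & forall u, 0 < y u -> \sum_(v | G u v) w v = mu * w u].
Proof.
case/eigenvalue_adjP => x [u0 xu0] xE.
pose y (u : T) : R := `|x u|.
have y_sub u : 0 <= w u * (\sum_(v | G u v) y v - mu * y u).
  rewrite mulr_ge0 ?subr_ge0 //; first exact: ltW.
  apply: le_trans (eigenvalue_norm xE u).
  by rewrite ler_wpM2r ?normr_ge0 // ler_norm.
have y_slack u : 0 <= y u * (mu * w u - \sum_(v | G u v) w v).
  by rewrite mulr_ge0 ?normr_ge0 ?subr_ge0.
have /eqP := supersolution_identity mu y.
rewrite subrr mul0r paddr_eq0 ?sumr_ge0 // => /andP[/eqP s1 /eqP s2].
exists y; split=> [u||u|u yu]; first exact: normr_ge0.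
- by exists u0; rewrite normr_gt0.
- have /eqP : w u * (\sum_(v | G u v) y v - mu * y u) = 0.
    exact: psumr_eq0P (fun v _ => y_sub v) s1 _ _.
  by rewrite mulf_eq0 gt_eqF // subr_eq0 => /eqP.
have /eqP : y u * (mu * w u - \sum_(v | G u v) w v) = 0.
  exact: psumr_eq0P (fun v _ => y_slack v) s2 _ _.
by rewrite mulf_eq0 gt_eqF // subr_eq0 => /eqP.
Qed.

End Supersolution.
End Eigenvalues.

Lemma isomorphic_eigenvalue (R : realType) (T U : finType) (G : sgraph T)
    (H : sgraph U) (l : R) :
  isomorphic G H -> eigenvalue (adjmx R G) l = eigenvalue (adjmx R H) l.
Proof.
case=> f bf fE; have [g fK gK] := bf.
apply/eigenvalue_adjP/eigenvalue_adjP => -[x [u xu] xE].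
  exists (x \o g) => [|v]; first by exists (f u); rewrite /= fK.
  rewrite /= -xE (reindex f) /=; last exact: onW_bij.
  by apply: eq_big => [t|t _]; rewrite ?fK // -fE gK.
exists (x \o f) => [|v]; first by exists (g u); rewrite /= gK.
rewrite /= -xE [RHS](reindex f) /=; last exact: onW_bij.
by apply: eq_bigl => t; rewrite fE.
Qed.

Lemma isomorphic_rho (R : realType) (T U : finType) (G : sgraph T)
    (H : sgraph U) :
  isomorphic G H -> rho R G = rho R H.
Proof.
move=> GH; rewrite /rho; congr (sup _); apply/boolp.funext => l /=.
by rewrite (isomorphic_eigenvalue l GH).
Qed.

(** * König's theorem *)

Section Konig.
Variables T U : finType.

Definition pair_cover (E : {set T * U}) (C : {set T}) (D : {set U}) :=
  [forall p in E, (p.1 \in C) || (p.2 \in D)].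

(** The proof deletes an edge [e]. Keeping [t] arbitrary, instead of the minimum size of a cover,
    lets the induction be used with the targets [t], [#|C|] and [#|D|]. *)
Theorem konig (E : {set T * U}) (t : nat) :
  (forall C D, pair_cover E C D -> (t <= #|C| + #|D|)%N) ->
  exists M : {set T * U}, [/\ M \subset E, (t <= #|M|)%N,
    {in M &, injective fst} & {in M &, injective snd}].
Proof.
have [m] := ubnP #|E|; elim: m E t => // m IH E t Em coverE.
have [E0|[e eE]] := set_0Vmem E.
  exists set0; rewrite sub0set cards0; split=> // [|p q|p q]; rewrite ?inE //.
  have := coverE set0 set0; rewrite !cards0; apply.
  by apply/forall_inP => p; rewrite E0 inE.
have smaller (E' : {set T * U}) : E' \subset E -> e \notin E' -> (#|E'| < m)%N.
  move=> sE eE'; suff /proper_card : E' \proper E by lia.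
  by rewrite properE sE; apply/subsetPn; exists e.
(* If the covers of [E :\ e] still have size at least [t], induction gives the matching without [e].
   Otherwise a smaller cover [C], [D] exists; it misses both ends of [e], and adding [e.1] to it
   covers [E]. *)
have [/forallP nocover|] :=
    boolP [forall C, forall D, pair_cover (E :\ e) C D ==> (t <= #|C| + #|D|)%N].
  have [||M [ME tM M1 M2]] := IH (E :\ e) t.
  - by apply: smaller; rewrite ?subsetDl // !inE eqxx.
  - by move=> C D; move/forallP: (nocover C) => /(_ D) /implyP.
  by exists M; split=> //; apply: subset_trans ME (subsetDl _ _).
rewrite negb_forall => /existsP[C]; rewrite negb_forall => /existsP[D].
rewrite negb_imply -ltnNge => /andP[/forall_inP CD CDt].
have eC : e.1 \notin C.
  apply/negP => eC; suff /coverE : pair_cover E C D by lia.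
  apply/forall_inP => p pE; have [->|pe] := eqVneq p e; first by rewrite eC.
  by apply: CD; rewrite !inE pe.
have eD : e.2 \notin D.
  apply/negP => eD; suff /coverE : pair_cover E C D by lia.
  apply/forall_inP => p pE; have [->|pe] := eqVneq p e; first by rewrite eD orbT.
  by apply: CD; rewrite !inE pe.
have tle : (t <= (#|C| + #|D|).+1)%N.
  have : pair_cover E (e.1 |: C) D.
    apply/forall_inP => p pE; rewrite !inE.
    have [->|pe] := eqVneq p e; first by rewrite eqxx.
    by have := CD p; rewrite !inE pe => /(_ pE) /orP[] ->; rewrite ?orbT.
  by move/coverE; rewrite cardsU1 eC addSn.
(* C, D cover E :\ e with #|C| + #|D| = t - 1. By minimality of covers of E, the
   edges from C avoiding D and e.2 have a matching saturating C, and those into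
   D avoiding C and e.1 have one saturating D; glue them with e. *)
have [||M1 [/subsetP M1E M1c M11 M12]] :=
    IH [set p in E | [&& p.1 \in C, p.2 \notin D & p.2 != e.2]] #|C|.
- apply: smaller; last by rewrite !inE eqxx !andbF.
  by apply/subsetP => p; rewrite inE => /andP[].
- move=> C' D' /forall_inP cov.
  (* An edge ending neither in [D] nor at [e.2] starts in [C], so it is one of the selected edges.
     Comparing the size of this cover with [t] leaves [#|C| <= #|C'| + #|D'|]. *)
  have : pair_cover E C' (e.2 |: D :|: D').
    apply/forall_inP => p pE; rewrite !inE.
    case: (eqVneq p.2 e.2) => [_|pe2]; first by rewrite orbT.
    case: (boolP (p.2 \in D)) => [_|pD]; first by rewrite !orbT.
    have pC : p.1 \in C.
      have := CD p; rewrite !inE pE (negbTE pD) orbF; apply.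
      by rewrite andbT; apply: contraNneq pe2 => ->.
    by have := cov p; rewrite !inE pE pC pD pe2 => /(_ isT) /orP[] ->; rewrite ?orbT.
  move/coverE; have [+ _] := leq_card_setU (e.2 |: D) D'.
  by rewrite cardsU1 eD; lia.
have [||M2 [/subsetP M2E M2c M21 M22]] :=
    IH [set p in E | [&& p.2 \in D, p.1 \notin C & p.1 != e.1]] #|D|.
- apply: smaller; last by rewrite !inE eqxx !andbF.
  by apply/subsetP => p; rewrite inE => /andP[].
- move=> C' D' /forall_inP cov.
  have : pair_cover E (e.1 |: C :|: C') D'.
    apply/forall_inP => p pE; rewrite !inE.
    case: (eqVneq p.1 e.1) => [//|pe1].
    case: (boolP (p.1 \in C)) => [_|pC]; first by rewrite !orbT.
    have pD : p.2 \in D.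
      have := CD p; rewrite !inE pE (negbTE pC) /=; apply.
      by rewrite andbT; apply: contraNneq pe1 => ->.
    by have := cov p; rewrite !inE pE pC pD pe1 => /(_ isT) /orP[] ->; rewrite ?orbT.
  move/coverE; have [+ _] := leq_card_setU (e.1 |: C) C'.
  by rewrite cardsU1 eC; lia.
have M1P p : p \in M1 -> [/\ p \in E, p.1 \in C, p.2 \notin D & p.2 != e.2].
  by move/M1E; rewrite !inE => /and4P[].
have M2P p : p \in M2 -> [/\ p \in E, p.2 \in D, p.1 \notin C & p.1 != e.1].
  by move/M2E; rewrite !inE => /and4P[].
have eM1 : e \notin M1 by apply/negP => /M1P[_ _ _]; rewrite eqxx.
have eM2 : e \notin M2 by apply/negP => /M2P[_ _ _]; rewrite eqxx.
have dM : [disjoint M1 & M2].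
  by apply/pred0P => p /=; apply/negP => /andP[/M1P[_ + _ _] /M2P[_ _ /negP]].
exists (e |: (M1 :|: M2)); split.
- by rewrite !subUset sub1set eE; apply/andP; split=> //; apply/andP; split;
     apply/subsetP => p; [case/M1P | case/M2P].
- have := leq_card_setU M1 M2; rewrite cardsU1 !inE negb_or eM1 eM2 /=.
  move: dM; rewrite -leq_card_setU => /eqP ->; lia.
(* First ends of [M1] lie in [C], those of [M2] lie outside [C] and differ from [e.1], and [e.1] is
   outside [C]; a collision can only occur within [M1] or within [M2]. *)
- move=> p q; rewrite !inE => /or3P[/eqP->|p1|p2] /or3P[/eqP->|q1|q2] //.
  + by move=> pq; case/M1P: q1 => _; rewrite -pq (negbTE eC).
  + by move=> pq; case/M2P: q2 => _ _ _; rewrite -pq eqxx.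
  + by move=> pq; case/M1P: p1 => _; rewrite pq (negbTE eC).
  + exact: M11.
  + by move=> pq; case/M1P: p1 => _; case/M2P: q2 => _ _; rewrite pq => /negbTE->.
  + by move=> pq; case/M2P: p2 => _ _ _; rewrite pq eqxx.
  + by move=> pq; case/M1P: q1 => _; case/M2P: p2 => _ _; rewrite pq => /negbTE->.
  + exact: M21.
move=> p q; rewrite !inE => /or3P[/eqP->|p1|p2] /or3P[/eqP->|q1|q2] //.
+ by move=> pq; case/M1P: q1 => _ _ _; rewrite -pq eqxx.
+ by move=> pq; case/M2P: q2 => _; rewrite -pq (negbTE eD).
+ by move=> pq; case/M1P: p1 => _ _ _; rewrite pq eqxx.
+ exact: M12.
+ by move=> pq; case/M1P: p1 => _ _; case/M2P: q2 => _; rewrite pq => ->.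
+ by move=> pq; case/M2P: p2 => _; rewrite pq (negbTE eD).
+ by move=> pq; case/M1P: q1 => _ _; case/M2P: p2 => _; rewrite pq => ->.
+ exact: M22.
Qed.

End Konig.

(** * Complete bipartite graphs minus a matching *)

Section PuncturedBipartite.
Variables (V : finType) (k : nat).

(* The pairs (f i, g i) are the edges of the deleted matching. *)
Definition mate (f g : 'I_k -> V) (u : V) : {set V} :=
  [set g i | i : 'I_k & f i == u] :|: [set f i | i : 'I_k & g i == u].

Definition punctured (A : {set V}) (f g : 'I_k -> V) : rel V :=
  fun u v => ((u \in A) != (v \in A)) && (v \notin mate f g u).

Lemma mateP f g u v :
  reflect (exists i, (f i = u /\ g i = v) \/ (g i = u /\ f i = v))
          (v \in mate f g u).
Proof.
apply: (iffP setUP) => [[]/imsetP[i]|[i [[fi gi]|[gi fi]]]].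
- by rewrite inE => /eqP fi ->; exists i; left.
- by rewrite inE => /eqP gi ->; exists i; right.
- by left; apply/imsetP; exists i; rewrite ?inE ?fi.
- by right; apply/imsetP; exists i; rewrite ?inE ?gi.
Qed.

Lemma mate_sym f g u v : (v \in mate f g u) = (u \in mate f g v).
Proof.
by apply/mateP/mateP => -[i [[? ?]|[? ?]]]; exists i; [right|left|right|left].
Qed.

Lemma punctured_sym A f g : symmetric (punctured A f g).
Proof. by move=> u v; rewrite /punctured eq_sym mate_sym. Qed.

(** Allows the larger part to be taken as the first side when matching with [Bgraph]. *)
Lemma punctured_setC A f g : punctured (~: A) g f =2 punctured A f g.
Proof.
move=> u v; rewrite /punctured /mate setUC ![_ \in ~: A]inE.
by case: (u \in A); case: (v \in A).
Qed.

Variables (A : {set V}) (f g : 'I_k -> V).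
Hypotheses (f_inj : injective f) (g_inj : injective g).
Hypotheses (fA : forall i, f i \in A) (gA : forall i, g i \notin A).

Lemma mate_f i : mate f g (f i) = [set g i].
Proof.
apply/setP => v; rewrite in_set1; apply/mateP/eqP => [[j [[/f_inj -> //]|[gf _]]]|->].
  by move: (gA j); rewrite gf fA.
by exists i; left.
Qed.

Lemma mate_g i : mate f g (g i) = [set f i].
Proof.
apply/setP => v; rewrite in_set1; apply/mateP/eqP => [[j [[fg _]|[/g_inj -> //]]]|->].
  by move: (gA i); rewrite -fg fA.
by exists i; right.
Qed.

Lemma mate_none u : u \notin codom f -> u \notin codom g -> mate f g u = set0.
Proof.
move=> uf ug; apply/setP => v; rewrite in_set0; apply/negP => /mateP[i [[fu _]|[gu _]]].
  by rewrite -fu codom_f in uf.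
by rewrite -gu codom_f in ug.
Qed.

Lemma codom_fA u : u \notin A -> u \notin codom f.
Proof. by apply: contraNN => /codomP[i ->]. Qed.

Lemma codom_gA u : u \in A -> u \notin codom g.
Proof. by move=> uA; apply/codomP => -[i ug]; move: (gA i); rewrite -ug uA. Qed.

Lemma card_mate u : (#|mate f g u| <= 1)%N.
Proof.
have [/codomP[i ->]|uf] := boolP (u \in codom f); first by rewrite mate_f cards1.
have [/codomP[i ->]|ug] := boolP (u \in codom g); first by rewrite mate_g cards1.
by rewrite mate_none ?cards0.
Qed.

Lemma mate_side u v : v \in mate f g u -> (u \in A) != (v \in A).
Proof. by case/mateP => i [[<- <-]|[<- <-]]; rewrite fA (negbTE (gA i)). Qed.

(** The opposite side has at least three vertices, and [u] and [v] each exclude at most one of them,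
    their mate. *)
Lemma punctured_common_neighbour u v :
  (2 < #|A|)%N -> (2 < #|~: A|)%N -> (u \in A) = (v \in A) ->
  exists2 w, punctured A f g u w & punctured A f g v w.
Proof.
move=> A3 B3 uv; pose O := [set w | (u \in A) != (w \in A)].
have O3 : (2 < #|O|)%N.
  have -> : O = if u \in A then ~: A else A.
    by apply/setP => w; case uA: (u \in A); rewrite !inE uA; case: (w \in A).
  by case: ifP.
have : (0 < #|O :\: (mate f g u :|: mate f g v)|)%N.
  have [cU _] := leq_card_setU (mate f g u) (mate f g v).
  have := cardsID (mate f g u :|: mate f g v) O.
  have := subset_leq_card (subsetIr O (mate f g u :|: mate f g v)).
  by have := card_mate u; have := card_mate v; lia.
case/card_gt0P => w; rewrite in_setD in_setU negb_or => /andP[/andP[wu wv]].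
rewrite inE => uw.
by exists w; rewrite /punctured -?uv uw.
Qed.

(** * The explicit weight and its defect *)

Section Weights.
Variable R : realType.

Lemma sum_punctured (w : V -> R) u :
  \sum_(v | punctured A f g u v) w v
  = \sum_(v | (u \in A) != (v \in A)) w v - \sum_(v in mate f g u) w v.
Proof.
have -> : \sum_(v in mate f g u) w v
    = \sum_(v | ((u \in A) != (v \in A)) && (v \in mate f g u)) w v.
  by apply: eq_bigl => v; apply/esym/andb_idl; exact: mate_side.
by rewrite [X in X - _](bigID [in mate f g u]) /= addrAC subrr add0r.
Qed.

Lemma sum_two_valued (O : {set V}) (h : 'I_k -> V) (c1 c2 : R) :
  injective h -> (forall i, h i \in O) ->
  \sum_(v in O) (if v \in codom h then c1 else c2)
  = k%:R * c1 + (#|O|%:R - k%:R) * c2.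
Proof.
move=> h_inj hO; rewrite (bigID [in codom h]) /=.
rewrite (eq_bigr (fun=> c1)) ?sumr_const => [|v /andP[_ ->] //].
rewrite (eq_bigr (fun=> c2)) ?sumr_const => [|v /andP[_ /negbTE ->] //].
have ck : #|[pred v | (v \in O) && (v \in codom h)]| = k.
  rewrite -[RHS]card_ord -(card_codom h_inj); apply: eq_card => v.
  rewrite !inE andbC; apply/andP/idP => [[]//|vh]; split=> //.
  by case/codomP: vh => i ->.
have cO := cardID [in codom h] [in O].
have -> : #|O|%:R = k%:R + #|[predD [in O] & [in codom h]]|%:R :> R.
  rewrite -natrD -[#|O|]cO; congr (_ + _)%:R.
  by rewrite -[RHS]ck; apply: eq_card.
rewrite -(mulr_natl c1) -(mulr_natl c2) ck [k%:R + _]addrC addrK; congr (_ + _ * _).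
by congr (_%:R); apply: eq_card => v; rewrite !inE andbC.
Qed.

Variables (x mu : R).
Let p : R := #|A|%:R.
Let q : R := #|~: A|%:R.

(* If mu ^+ 2 = x this is the positive vector for which the eigenvalue equation
   for mu of the punctured K_{p,q} holds on A, up to scaling. *)
Definition weight (u : V) : R :=
  if u \in A then if u \in codom f then x * (q - 1) else (x - 1) * q + k%:R
  else mu * (if u \in codom g then x - q + k%:R else x + k%:R - 1).

(** Expands to [x^2 - (p q - 2 k + 1) x + (p - k) (q - k)], the quadratic of the theorem for parts
    of sizes [p] and [q]. It measures the failure of the eigenvalue equation off [A], by the same
    amount at matched and unmatched vertices. *)
Definition defect : R :=
  x * (x + k%:R - 1) - (k%:R * x * (q - 1) + (p - k%:R) * ((x - 1) * q + k%:R)).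

Hypotheses (mu_gt0 : 0 < mu) (mu2 : mu ^+ 2 = x).

Lemma sum_weight_A u : u \in A ->
  \sum_(v | punctured A f g u v) weight v = mu * weight u.
Proof.
move=> uA; rewrite sum_punctured uA.
rewrite (eq_bigr (fun v => mu * (if v \in codom g then x - q + k%:R
                                 else x + k%:R - 1))); last first.
  by move=> v /= /eqP vA; rewrite /weight; case: ifP => // vA'; rewrite vA' in vA.
rewrite (eq_bigl [in ~: A]); last by move=> v; rewrite !inE; case: (v \in A).
rewrite -mulr_sumr sum_two_valued //; last by move=> i; rewrite inE.
rewrite [weight u]/weight uA; case: ifP => [/codomP[i ->]|/negbT uf].
  by rewrite mate_f big_set1 /weight (negbTE (gA i)) codom_f -/q; ring.
by rewrite mate_none ?codom_gA // big_set0 -/q; ring.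
Qed.

Lemma sum_weight_B u : u \notin A ->
  \sum_(v | punctured A f g u v) weight v = mu * weight u - defect.
Proof.
move=> uA; rewrite sum_punctured (negbTE uA).
rewrite (eq_bigr (fun v => if v \in codom f then x * (q - 1)
                           else (x - 1) * q + k%:R)); last first.
  by move=> v /= /eqP vA; rewrite /weight; case: (v \in A) vA.
rewrite (eq_bigl [in A]); last by move=> v; case: (v \in A).
rewrite sum_two_valued // [weight u]/weight (negbTE uA) [mu * (mu * _)]mulrA -expr2 mu2 /defect.
case: ifP => [/codomP[i ->]|/negbT ug].
  by rewrite mate_g big_set1 /weight fA codom_f -/p -/q; ring.
by rewrite mate_none ?codom_fA // big_set0 -/p; ring.
Qed.

Hypotheses (x_gt1 : 1 < x) (x_gtq : q < x) (q_gt1 : 1 < q).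

Lemma weight_gt0 u : 0 < weight u.
Proof.
have k0 : 0 <= k%:R :> R by [].
have x0 : 0 < x by apply: lt_trans x_gt1.
rewrite /weight; case: ifP => _; case: ifP => _.
- by rewrite mulr_gt0 ?subr_gt0.
- by rewrite ltr_wpDr // mulr_gt0 ?subr_gt0 // (lt_trans _ q_gt1).
- by rewrite mulr_gt0 // ltr_wpDr ?subr_gt0.
- by rewrite mulr_gt0 // addrAC ltr_wpDr ?subr_gt0.
Qed.

Variable G : sgraph V.
Hypothesis sG : subrel G (punctured A f g).

Lemma le_sum_weight u :
  \sum_(v | G u v) weight v <= \sum_(v | punctured A f g u v) weight v.
Proof.
rewrite [leLHS]big_mkcond [leRHS]big_mkcond ler_sum // => v _.
by have [/sG ->//|_] := ifP; case: ifP => // _; rewrite ltW ?weight_gt0.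
Qed.

(** All weights are positive, so a single missing edge at [u] makes the sum strictly smaller. *)
Lemma le_sum_weight_eq u :
  \sum_(v | G u v) weight v = \sum_(v | punctured A f g u v) weight v ->
  G u =1 punctured A f g u.
Proof.
move=> e v; apply/idP/idP => [/sG//|uv].
apply: contra_eqT e => Guv; rewrite lt_eqF //.
rewrite [ltRHS](bigD1 v) //= ltr_pwDl ?weight_gt0 //.
rewrite [leLHS]big_mkcond [leRHS]big_mkcond ler_sum // => t _.
have [ut|_] := ifP; last by case: ifP => // _; rewrite ltW ?weight_gt0.
by rewrite (sG ut) /=; case: eqVneq ut => // ->; rewrite (negbTE Guv).
Qed.

Hypothesis defect_ge0 : 0 <= defect.

Lemma weight_super u : \sum_(v | G u v) weight v <= mu * weight u.
Proof.
apply: le_trans (le_sum_weight u) _.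
have [uA|uA] := boolP (u \in A); first by rewrite sum_weight_A.
by rewrite sum_weight_B // gerBl.
Qed.

Lemma punctured_eigenvalue_le (l : R) : eigenvalue (adjmx R G) l -> l <= mu.
Proof. exact: le_supersolution weight_gt0 weight_super l. Qed.

Lemma punctured_eigenvalue :
  (0 < #|V|)%N -> G =2 punctured A f g -> defect = 0 -> eigenvalue (adjmx R G) mu.
Proof.
move=> /card_gt0P[u0 _] GE F0; apply/eigenvalue_adjP; exists weight.
  by exists u0; rewrite gt_eqF ?weight_gt0.
move=> u; rewrite (eq_bigl _ _ (GE u)).
have [uA|uA] := boolP (u \in A); first by rewrite sum_weight_A.
by rewrite sum_weight_B // F0 subr0.
Qed.

(** Where [y] is positive the supersolution is tight, which leaves no room for a missing edge, nor
    for a positive defect off [A]. *)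
Lemma punctured_eigen_support :
  eigenvalue (adjmx R G) mu ->
  exists y : V -> R, [/\ forall u, 0 <= y u, exists u, 0 < y u,
    forall u, \sum_(v | G u v) y v = mu * y u,
    forall u, 0 < y u -> G u =1 punctured A f g u
  & forall u, 0 < y u -> u \notin A -> defect = 0].
Proof.
move=> /(supersolution_eq weight_gt0 weight_super)[y [y_ge0 ys yE y_tight]].
have y_full u : 0 < y u -> G u =1 punctured A f g u.
  move=> /y_tight e; apply: le_sum_weight_eq; apply/le_anti.
  rewrite le_sum_weight e /=.
  have [uA|uA] := boolP (u \in A); first by rewrite sum_weight_A.
  by rewrite sum_weight_B // gerBl.
exists y; split=> // u yu uA; have := y_tight u yu.
rewrite (eq_bigl _ _ (y_full u yu)) sum_weight_B // => /eqP.
by rewrite -subr_eq0 addrC addKr oppr_eq0 => /eqP.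
Qed.

(** The support of [y] cannot lie inside [A]: since [mu] is positive, a support vertex in [A] has a
    neighbour in the support, and this neighbour is off [A]. *)
Lemma punctured_extremal_defect : eigenvalue (adjmx R G) mu -> defect = 0.
Proof.
case/punctured_eigen_support => y [y_ge0 [s ys] yE _ yB].
have [sA|] := boolP (s \in A); last exact: yB.
have [v /andP[sv yv]|y0] := pickP [pred v | G s v && (0 < y v)].
  by apply: (yB v) => //; move: (sG sv); rewrite /punctured sA; case: (v \in A).
have /eqP : \sum_(v | G s v) y v = 0.
  apply: big1 => v sv; apply/eqP; rewrite eq_le y_ge0 andbT leNgt.
  by have := y0 v; rewrite /= sv /= => ->.
by rewrite yE mulf_eq0 !gt_eqF.
Qed.

(** The support of [y] is closed under adjacency in the punctured graph, because [G] has all these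
    edges there. That graph is connected, so the support is everything. *)
Lemma punctured_extremal :
  (2 < #|A|)%N -> (2 < #|~: A|)%N -> eigenvalue (adjmx R G) mu ->
  G =2 punctured A f g.
Proof.
move=> A3 B3 /punctured_eigen_support[y [y_ge0 [s ys] yE y_full _]].
have y_closed u v : 0 < y u -> punctured A f g u v -> 0 < y v.
  move=> yu uv; have Gvu : G v u by rewrite adj_sym (y_full u yu).
  rewrite -(pmulr_rgt0 _ mu_gt0) -yE (bigD1 u) //= ltr_pwDl //.
  by rewrite sumr_ge0.
have y_side u v : 0 < y u -> (u \in A) = (v \in A) -> 0 < y v.
  move=> yu /(punctured_common_neighbour A3 B3)[w uw vw].
  by apply: (y_closed w); [exact: (y_closed u)|rewrite punctured_sym].
have ypos v : 0 < y v.
  have [/(y_side s v ys)//|sv] := eqVneq (s \in A) (v \in A).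
  (* Used with both vertices equal to [s], just to obtain one neighbour, which lies on the side of
     [v]. *)
  have [w sw _] := punctured_common_neighbour A3 B3 (erefl (s \in A)).
  apply: (y_side w); first exact: (y_closed s).
  by move: sw sv; rewrite /punctured; case: (s \in A); case: (w \in A); case: (v \in A).
by move=> u v; rewrite y_full.
Qed.

End Weights.
End PuncturedBipartite.

(** * Punctured balanced graphs and [Bgraph] *)

Section BgraphIsPunctured.
Variables n k : nat.

Lemma extend_numbering (V : finType) (A : {set V}) (f : 'I_k -> V) (a : nat) :
  injective f -> (forall i, f i \in A) -> #|A| = a -> (0 < a)%N ->
  exists h : V -> 'I_a,
    {in A &, injective h} /\ forall i, h (f i) = i :> nat.
Proof.
move=> f_inj fA Aa a0.
(* The matched vertices are listed first, in the order of ['I_k], so that [f i] has position [i]. *)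
pose s := codom f ++ [seq v <- enum A | v \notin codom f].
have sA v : (v \in s) = (v \in A).
  rewrite mem_cat mem_filter mem_enum.
  by have [/codomP[i ->]|] := boolP (v \in codom f); rewrite ?fA.
have s_uniq : uniq s.
  rewrite cat_uniq filter_uniq ?enum_uniq // andbT.
  rewrite map_inj_uniq ?enum_uniq //=.
  by apply/hasPn => v; rewrite mem_filter => /andP[].
have sz : size s = a by rewrite -Aa -(eq_card sA); apply/esym/card_uniqP.
(* Off [A] the index equals [a], out of range, and [h] takes the default value; injectivity is
   claimed on [A] only. *)
pose h v : 'I_a := insubd (Ordinal a0) (index v s).
have hE v : v \in A -> h v = index v s :> nat.
  by rewrite -sA -index_mem sz => vs; rewrite val_insubd vs.
exists h; split=> [u v uA vA /(congr1 val)|i].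
  by rewrite /= !hE // => /index_inj; apply; rewrite ?sA.
rewrite hE // index_cat codom_f /codom /image_mem index_map //.
by rewrite index_enum_ord.
Qed.

Lemma punctured_isomorphic (V : finType) (G : sgraph V) (A : {set V})
    (f g : 'I_k -> V) :
  injective f -> injective g ->
  (forall i, f i \in A) -> (forall i, g i \notin A) ->
  #|A| = uphalf n -> #|~: A| = n./2 -> (0 < n./2)%N ->
  G =2 punctured A f g -> isomorphic G (Bgraph n k).
Proof.
move=> f_inj g_inj fA gA cA cB n0 GE.
have a0 : (0 < uphalf n)%N by lia.
have gB i : g i \in ~: A by rewrite inE.
have [hA [hA_inj hAf]] := extend_numbering f_inj fA cA a0.
have [hB [hB_inj hBg]] := extend_numbering g_inj gB cB n0.
pose phi v : B_vertex n := if v \in A then inl (hA v) else inr (hB v).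
exists phi.
  apply: inj_card_bij => [u v|]; last first.
    by rewrite card_sum !card_ord -cA -cB cardsC.
  rewrite /phi; case: ifP => uA; case: ifP => vA // [].
    exact: hA_inj.
  by apply: hB_inj; rewrite !inE ?uA ?vA.
have cross u v : u \in A -> v \notin A ->
    ~~ ((hA u == hB v :> nat) && (hA u < k)%N) = (v \notin mate f g u).
  move=> uA vA; congr (~~ _); apply/andP/mateP => [[/eqP uv uk]|[i]].
    exists (Ordinal uk); left; split.
      by apply: hA_inj => //; apply: val_inj; rewrite /= hAf.
    by apply: hB_inj; rewrite ?inE //; apply: val_inj; rewrite /= hBg.
  case=> -[E1 E2]; last by move: vA; rewrite -E2 fA.
  by rewrite -E1 -E2 hAf hBg.
move=> u v; rewrite GE /punctured /= /B_rel /phi.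
case: ifP => uA; case: ifP => vA //=; first by rewrite cross ?vA.
rewrite mate_sym -cross ?uA //.
Qed.

Hypotheses (kn : (2 * k <= n)%N) (n0 : (0 < n)%N).

Lemma Bgraph_punctured : exists (A : {set B_vertex n}) (f g : 'I_k -> B_vertex n),
  [/\ injective f, injective g,
      (forall i, f i \in A) & (forall i, g i \notin A)] /\
  [/\ #|A| = uphalf n, #|~: A| = n./2 & Bgraph n k =2 punctured A f g].
Proof.
have ka : (k <= uphalf n)%N by lia.
have kb : (k <= n./2)%N by lia.
pose A : {set B_vertex n} := [set v | if v is inl _ then true else false].
have cA : #|A| = uphalf n.
  have -> : A = [set inl i | i : 'I_(uphalf n)].
    apply/setP => -[i|j]; rewrite inE; apply/esym; first exact: imset_f.
    by apply/imsetP => -[].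
  by rewrite card_imset ?card_ord // => i j [].
pose f i : B_vertex n := inl (widen_ord ka i).
pose g i : B_vertex n := inr (widen_ord kb i).
exists A, f, g.
split; first split.
- by move=> i j [] ij; apply: val_inj.
- by move=> i j [] ij; apply: val_inj.
- by move=> i; rewrite inE.
- by move=> i; rewrite inE.
split=> //.
  have := cardsC A; rewrite cA card_sum !card_ord.
  by move/addnI.
have cross (i : 'I_(uphalf n)) (j : 'I_n./2) :
    ~~ ((i == j :> nat) && (i < k)%N) =
    ((inr j : B_vertex n) \notin mate f g (inl i)).
  congr (~~ _); apply/andP/mateP => [[/eqP ij ik]|[l [[[<-] [<-]]|[]//]]].
    by exists (Ordinal ik); left; split; [congr inl|congr inr]; apply: val_inj.
  by rewrite /= eqxx ltn_ord.
move=> [i|i] [j|j]; rewrite /punctured ![_ \in A]inE /= ?cross //.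
by congr (~~ _); exact: mate_sym.
Qed.

End BgraphIsPunctured.

(** * Triangle-free graphs *)

Section TriangleFree.
Variables (V : finType) (G : sgraph V).

(** Walks of length 2 from [u] are counted by their endpoint, which is not a neighbour of [u] since
    that would close a triangle. *)
Lemma sum_degree_neighbours u : triangle_free G ->
  (\sum_(v | G u v) #|[set w | G v w]|)%N
  = (\sum_(w in ~: [set v | G u v]) #|[set v | G w v] :&: [set v | G u v]|)%N.
Proof.
move=> tf; under eq_bigr do rewrite -sum1_card.
rewrite (exchange_big_dep [in ~: [set v | G u v]]) /=; last first.
  by move=> v w uv; rewrite !inE => vw; apply/negP => uw;
     move/negP: (tf u v w); rewrite uv vw uw.
apply: eq_bigr => w _; rewrite sum1dep_card; apply: eq_card => v.
by rewrite !inE andbC (adj_sym G v w).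
Qed.

Lemma sum_degree_neighbours_le u : triangle_free G ->
  (\sum_(v | G u v) #|[set w | G v w]|
    <= #|[set v | G u v]| * #|~: [set v | G u v]|)%N.
Proof.
move=> /sum_degree_neighbours ->; rewrite mulnC -sum_nat_const.
by apply: leq_sum => w _; rewrite subset_leq_card ?subsetIr.
Qed.

(** The adjacent vertices [y] and [z] have disjoint neighbourhoods, so together they contribute at
    most as much as one endpoint may. *)
Lemma sum_degree_neighbours_lt u y z : triangle_free G ->
  ~~ G u y -> ~~ G u z -> G y z ->
  (\sum_(v | G u v) #|[set w | G v w]|
    <= #|[set v | G u v]| * #|~: [set v | G u v]|.-1)%N.
Proof.
move=> tf uy uz yz; rewrite sum_degree_neighbours //.
set A := [set v | G u v].
have yB : y \in ~: A by rewrite !inE.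
have zy : z != y by apply: contraTneq yz => ->; rewrite adj_irr.
have zB : z \in ~: A :\ y by rewrite !inE zy.
rewrite (cardsD1 y (~: A)) yB (cardsD1 z (~: A :\ y)) zB /= (big_setD1 y) //.
rewrite (big_setD1 z) //=.
have dis : (#|[set v | G y v] :&: A| + #|[set v | G z v] :&: A| <= #|A|)%N.
  rewrite -cardsUI [X in (_ + X)%N](_ : _ = 0%N) ?addn0.
    by rewrite subset_leq_card // subUset !subsetIr.
  apply/eqP; rewrite cards_eq0; apply/eqP/setP => v; rewrite !inE.
  apply/negP => /andP[/andP[yv _] /andP[zv _]].
  by move/negP: (tf y z v); rewrite yz zv yv.
have rest : (\sum_(w in ~: A :\ y :\ z) #|[set v | G w v] :&: A|
             <= #|A| * #|~: A :\ y :\ z|)%N.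
  rewrite mulnC -sum_nat_const.
  by apply: leq_sum => w _; rewrite subset_leq_card ?subsetIr.
by rewrite addnA mulnS leq_add.
Qed.

End TriangleFree.

(** * Connectivity of the complement and matchings of missing edges *)

Lemma vconn_le (V : finType) (G : sgraph V) (S : {set V}) :
  disconnects G S -> (vconn G <= #|S|)%N.
Proof.
move=> dS; apply: (@Order.TotalTheory.bigmin_le_cond _ nat _ _ S).
by rewrite dS.
Qed.

Lemma missing_matching (V : finType) (G : sgraph V) (A : {set V}) (k : nat) :
  (k <= vconn (compl G))%N -> (k <= #|A|)%N -> (k <= #|~: A|)%N ->
  exists f g : 'I_k -> V, [/\ injective f, injective g,
    (forall i, f i \in A), (forall i, g i \notin A)
    & forall i, ~~ G (f i) (g i)].
Proof.
move=> kG kA kB.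
pose E := [set p : V * V | [&& p.1 \in A, p.2 \notin A & ~~ G p.1 p.2]].
have [|M [/subsetP ME kM M1 M2]] := @konig _ _ E k.
  move=> C D /forall_inP cov; rewrite leqNgt; apply/negP => CDk.
  have cS := (leq_card_setU C D).1; set S := C :|: D in cS.
  have rest (B : {set V}) : (k <= #|B|)%N -> exists2 v, v \in B & v \notin S.
    move=> kB'; suff /card_gt0P[v] : (0 < #|B :\: S|)%N.
      by rewrite inE => /andP[]; exists v.
    by have := cardsID S B; have := subset_leq_card (subsetIr B S); lia.
  have [u uA uS] := rest A kA; have [v vB vS] := rest _ kB.
  suff /vconn_le : disconnects (compl G) S by lia.
  apply/existsP; exists u; rewrite inE uS; apply/existsP; exists v.
  rewrite inE vS /=; apply/negP => /closed_connect cl.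
  have /cl : closed (del_rel (compl G) S) A; last first.
    by move: vB; rewrite uA inE => /negbTE ->.
  (* A complement edge leaving [A] belongs to [E], so the cover puts one of its ends into [S]. *)
  have crossing y z : del_rel (compl G) S y z -> y \in A -> z \in A.
    move=> /and3P[yS zS /andP[_ yz]] yA; apply/negPn/negP => zA.
    have := cov (y, z); rewrite inE /= yA zA yz => /(_ isT).
    by move: yS zS; rewrite !inE !negb_or => /andP[/negbTE-> _] /andP[_ /negbTE->].
  move=> y z yz; apply/idP/idP; first exact: crossing.
  apply: crossing; move: yz; rewrite /del_rel adj_sym.
  by case/and3P => -> -> ->.
pose e i := enum_val (widen_ord kM i).
have eM i : e i \in M by exact: enum_valP.
have e_inj : injective e.
  by move=> i j /enum_val_inj /(congr1 val) ij; apply: val_inj.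
have eE i : [&& (e i).1 \in A, (e i).2 \notin A & ~~ G (e i).1 (e i).2].
  by have := ME _ (eM i); rewrite inE.
exists (fun i => (e i).1), (fun i => (e i).2); split.
- by move=> i j /(M1 _ _ (eM i) (eM j)) /e_inj.
- by move=> i j /(M2 _ _ (eM i) (eM j)) /e_inj.
- by move=> i; case/and3P: (eE i).
- by move=> i; case/and3P: (eE i).
- by move=> i; case/and3P: (eE i).
Qed.

(** * The extremal bound *)

(** At [c - 1] the polynomial [X^2 - c X + P] takes the value [P - (c - 1) < 0], so this point lies
    below the larger root. Equivalently, the discriminant exceeds [(c - 2)^2]. *)
Lemma quadratic_larger_root (R : rcfType) (c P : R) : P < c - 1 ->
  let x := (c + Num.sqrt (c ^+ 2 - 4 * P)) / 2 in
  c - 1 < x /\ x ^+ 2 = c * x - P.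
Proof.
move=> Pc; set s := Num.sqrt _ => /=.
have c2 : 0 <= (c - 2) ^+ 2 by exact: sqr_ge0.
have D0 : 0 <= c ^+ 2 - 4 * P by nra.
have s0 : 0 <= s by exact: sqrtr_ge0.
have s2 : s ^+ 2 = c ^+ 2 - 4 * P by rewrite sqr_sqrtr.
split; last by nra.
have : c - 2 < s by nra.
by lra.
Qed.

(** No integer lies strictly between [b] and [a]. If [b = p + d] then [a b - p q = d (a - p)]; if
    [p = a + d] then [a b - p q = d (a - q)]. *)
Lemma balanced_product (p q a b : nat) :
  (p + q = a + b)%N -> (b <= a <= b.+1)%N ->
  (p * q <= a * b)%N /\ ((p * q = a * b)%N -> p = a \/ p = b).
Proof.
move=> pq /andP[ba ab]; have [pb|bp] := leqP p b.
  have [d bE] : exists d, b = (p + d)%N by exists (b - p)%N; lia.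
  have -> : q = (a + d)%N by lia.
  subst b; split=> [|e]; first by nia.
  have /eqP : (d * p = d * a)%N by nia.
  by rewrite eqn_mul2l; lia.
have [d pE] : exists d, p = (a + d)%N by exists (p - a)%N; lia.
have -> : b = (q + d)%N by lia.
subst p; split=> [|e]; first by nia.
have /eqP : (d * q = d * a)%N by nia.
by rewrite eqn_mul2l; lia.
Qed.

(** With [a = p + d] and [b = p + e] the difference [a b - p q] is exactly [d e], and both factors
    are at least [k + 1]. *)
Lemma unbalanced_product (p q a b k : nat) :
  (p + q = a + b)%N -> (p <= k)%N -> (2 * k < b)%N -> (b <= a)%N ->
  (p * q + 2 * k <= a * b)%N.
Proof.
move=> pq pk kb ba.
have [d aE] : exists d, a = (p + d)%N by exists (a - p)%N; lia.
have [e bE] : exists e, b = (p + e)%N by exists (b - p)%N; lia.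
have -> : q = (p + d + e)%N by lia.
have : ((k + 1) * (k + 1) <= d * e)%N by rewrite leq_mul //; lia.
by subst a b; nia.
Qed.

Section Extremal.
Variables (R : realType) (n k : nat).
Hypotheses (k_ge1 : (1 <= k)%N) (n_ge : (4 * k + 2 <= n)%N).

Let a := uphalf n.
Let b := n./2.

Lemma half_facts : [/\ (a + b = n)%N, (b <= a)%N, (a <= b.+1)%N & (2 * k < b)%N].
Proof. by rewrite /a /b; split; lia. Qed.

Definition rho_sqr : R :=
  let a : R := (uphalf n)%:R in
  let b : R := (n./2)%:R in
  let c : R := a * b - 2 * k%:R + 1 in
  (c + Num.sqrt (c ^+ 2 - 4 * (a - k%:R) * (b - k%:R))) / 2.

Lemma rho_sqr_facts :
  (a * b)%:R - 2 * k%:R < rho_sqr /\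
  rho_sqr ^+ 2 = (a%:R * b%:R - 2 * k%:R + 1) * rho_sqr
                 - (a%:R - k%:R) * (b%:R - k%:R).
Proof.
have [_ ba _ kb] := half_facts.
have kbR : 2 * k%:R + 1 <= b%:R :> R by rewrite -natrM natr1 ler_nat.
have baR : b%:R <= a%:R :> R by rewrite ler_nat.
have k1R : 1 <= k%:R :> R by rewrite ler1n.
have := @quadratic_larger_root R (a%:R * b%:R - 2 * k%:R + 1)
          ((a%:R - k%:R) * (b%:R - k%:R)).
rewrite addrK mulrA natrM; apply; nra.
Qed.

(** Makes [rho_sqr] exceed the size of either part, whatever the bipartition, as positivity of
    [weight] requires. *)
Lemma rho_sqr_gt_n : n%:R < rho_sqr.
Proof.
have [abn ba ab kb] := half_facts; apply: le_lt_trans rho_sqr_facts.1.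
rewrite lerBrDr -natrM -natrD ler_nat.
by nia.
Qed.

Lemma rho_sqr_gt1 : 1 < rho_sqr.
Proof. by apply: lt_trans rho_sqr_gt_n; rewrite ltr1n; lia. Qed.

Let mu := Num.sqrt rho_sqr.

Lemma mu_sqr : mu ^+ 2 = rho_sqr.
Proof. by rewrite sqr_sqrtr // ltW // (lt_trans _ rho_sqr_gt1). Qed.

Lemma mu_gt0 : 0 < mu.
Proof. by rewrite sqrtr_gt0 (lt_trans _ rho_sqr_gt1). Qed.

(** Common exit of the cases that stay away from the extremal graph; strictness excludes equality
    there. *)
Lemma lt_mu_of_sqr (l : R) (m : nat) :
  l ^+ 2 <= m%:R -> (m + 2 * k <= a * b)%N -> l < mu.
Proof.
move=> lm mab; have l2 : l ^+ 2 < mu ^+ 2.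
  rewrite mu_sqr; apply: le_lt_trans lm _; apply: le_lt_trans rho_sqr_facts.1.
  by rewrite lerBrDr -natrM -natrD ler_nat.
by have := mu_gt0; nra.
Qed.

(** * Spanning subgraphs of a punctured bipartite graph *)

Section Punctured.
Variables (V : finType) (G : sgraph V) (A : {set V}) (f g : 'I_k -> V).
Hypotheses (f_inj : injective f) (g_inj : injective g).
Hypotheses (fA : forall i, f i \in A) (gA : forall i, g i \notin A).
Hypotheses (Vn : #|V| = n) (kB : (1 < #|~: A|)%N).
Hypothesis sG : subrel G (punctured A f g).

Let cards : (#|A| + #|~: A| = n)%N.
Proof. by rewrite cardsC. Qed.

Lemma card_prod_le : (#|A| * #|~: A| <= a * b)%N.
Proof.
have [abn ba ab _] := half_facts.
by apply: (balanced_product _ _).1; rewrite ?cards ?abn ?ba.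
Qed.

(** As both pairs of part sizes have sum [n], subtracting the equation of [rho_sqr] changes the
    linear coefficient and the constant term by opposite multiples of the same difference of
    products. *)
Lemma defectE :
  defect k A rho_sqr = (rho_sqr - 1) * ((a * b)%:R - (#|A| * #|~: A|)%:R).
Proof.
have [_ rt] := rho_sqr_facts; rewrite /defect !natrM.
have [abn _ _ _] := half_facts.
have pq : #|A|%:R = a%:R + b%:R - #|~: A|%:R :> R.
  by rewrite -natrD abn -cards natrD addrK.
by rewrite pq; ring: rt.
Qed.

Let defect_ge0 : 0 <= defect k A rho_sqr.
Proof.
rewrite defectE mulr_ge0 // subr_ge0 ?ler_nat ?card_prod_le //.
exact: ltW rho_sqr_gt1.
Qed.

Let B_lt : #|~: A|%:R < rho_sqr.
Proof. by apply: le_lt_trans rho_sqr_gt_n; rewrite ler_nat -cards leq_addl. Qed.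

Let B_gt1 : 1 < #|~: A|%:R :> R.
Proof. by rewrite ltr1n. Qed.

Lemma punctured_eigen_le (l : R) : eigenvalue (adjmx R G) l -> l <= mu.
Proof.
exact: (punctured_eigenvalue_le f_inj g_inj fA gA mu_gt0 mu_sqr rho_sqr_gt1
          B_lt B_gt1 sG defect_ge0).
Qed.

Lemma punctured_eigen_mu :
  #|A| = a -> G =2 punctured A f g -> eigenvalue (adjmx R G) mu.
Proof.
move=> Aa GE.
apply: (punctured_eigenvalue f_inj g_inj fA gA mu_gt0 mu_sqr rho_sqr_gt1
          B_lt B_gt1 _ GE); first by rewrite Vn; lia.
have [abn _ _ _] := half_facts.
have Bb : #|~: A| = b by lia.
by rewrite defectE Aa Bb subrr mulr0.
Qed.

Lemma punctured_eigen_iso :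
  eigenvalue (adjmx R G) mu -> isomorphic G (Bgraph n k).
Proof.
move=> e; have [abn ba ab kb] := half_facts.
have /eqP := punctured_extremal_defect f_inj g_inj fA gA mu_gt0 mu_sqr
  rho_sqr_gt1 B_lt B_gt1 sG defect_ge0 e.
rewrite defectE mulf_eq0 subr_eq0 gt_eqF ?rho_sqr_gt1 //= subr_eq0 eqr_nat.
move=> /eqP pq.
have GE := punctured_extremal f_inj g_inj fA gA mu_gt0 mu_sqr
  rho_sqr_gt1 B_lt B_gt1 sG defect_ge0 _ _ e.
have [||Aa|Ab] := (@balanced_product #|A| #|~: A| a b _ _).2 (esym pq).
- by rewrite cards.
- by rewrite ba.
  apply: (punctured_isomorphic f_inj g_inj fA gA) => //; try lia.
  by apply: GE; lia.
(* Here [A] has size [b], so the two sides and the two ends of the matching are exchanged. *)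
apply: (@punctured_isomorphic n k _ G (~: A) g f) => //.
- by move=> i; rewrite inE.
- by move=> i; rewrite inE fA.
- by rewrite -/a; lia.
- by rewrite setCK.
- by rewrite -/b; lia.
by move=> u v; rewrite punctured_setC GE //; lia.
Qed.

End Punctured.

(** The comparison bounds every eigenvalue by [mu], and for balanced parts the defect vanishes, so
    that [mu] is attained. *)
Lemma rho_Bgraph : rho R (Bgraph n k) = mu.
Proof.
have [abn ba ab kb] := half_facts.
have [||A [f [g [[f_inj g_inj fA gA] [Aa Bb GE]]]]] := @Bgraph_punctured n k; try lia.
have Vn : #|B_vertex n| = n by rewrite -(cardsC A) Aa Bb.
have B1 : (1 < #|~: A|)%N by rewrite Bb; lia.
have sG : subrel (Bgraph n k) (punctured A f g) by move=> u v; rewrite GE.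
apply/le_anti/andP; split.
  apply: (punctured_eigen_le f_inj g_inj fA gA Vn B1 sG).
  by apply: rho_eigenvalue; rewrite Vn; lia.
by apply: le_rho; exact: (punctured_eigen_mu f_inj g_inj fA gA Vn B1 Aa GE).
Qed.

Lemma extremal_eigenvalue (V : finType) (G : sgraph V) (l : R) :
  #|V| = n -> triangle_free G -> (k <= vconn (compl G))%N ->
  eigenvalue (adjmx R G) l ->
  l <= mu /\ (l = mu -> isomorphic G (Bgraph n k)).
Proof.
move=> Vn tf kG e; have [abn ba ab kb] := half_facts.
have small m : l ^+ 2 <= m%:R -> (m + 2 * k <= a * b)%N ->
    l <= mu /\ (l = mu -> isomorphic G (Bgraph n k)).
  move=> lm mab; have lmu := lt_mu_of_sqr lm mab.
  by split; [exact: ltW | move=> E; rewrite E ltxx in lmu].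
have [u lu] := eigenvalue_walk2 e.
pose A := [set v | G u v].
have cards : (#|A| + #|~: A| = n)%N by rewrite cardsC.
(* The vertex [u] is not its own neighbour; hence the predecessor of [#|~: A|] below is a true
   subtraction. *)
have B0 : (0 < #|~: A|)%N.
  by apply/card_gt0P; exists u; rewrite !inE adj_irr.
have [/existsP[y /existsP[z /and3P[uy uz yz]]]|noedge] :=
    boolP [exists y, exists z, [&& ~~ G u y, ~~ G u z & G y z]].
  apply: (small _ lu); have := sum_degree_neighbours_lt tf uy uz yz.
  (* The sizes [#|A|] and [#|~: A| - 1] add up to [n - 1], whose balanced split is [b], [a - 1].
     Their product is at most [a b - b], and [b > 2 k]. *)
  rewrite -/A; have [||+ _] := @balanced_product #|A| #|~: A|.-1 b a.-1; lia.
have bip y z : G y z -> (y \in A) != (z \in A).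
  move=> yz; apply/negP => /eqP; rewrite !inE.
  case uy: (G u y) => /esym uz.
    by move/negP: (tf u y z); rewrite uy yz uz.
  move/negP: noedge; apply; apply/existsP; exists y; apply/existsP; exists z.
  by rewrite uy uz yz.
have lAB := sum_degree_neighbours_le u tf; rewrite -/A in lAB.
have [kA|Ak] := ltnP k #|A|; last first.
  apply: (small _ lu); apply: leq_trans (unbalanced_product _ Ak kb ba).
    by rewrite leq_add2r; exact: lAB.
  by rewrite cards.
have [kB|Bk] := ltnP k #|~: A|; last first.
  apply: (small _ lu); apply: leq_trans (unbalanced_product _ Bk kb ba).
    by rewrite leq_add2r mulnC; exact: lAB.
  by rewrite addnC cards.
have [f [g [f_inj g_inj fA gA fgG]]] :=
  missing_matching kG (ltnW kA) (ltnW kB).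
have sG : subrel G (punctured A f g).
  move=> y z yz; rewrite /punctured bip //=; apply/negP => /mateP[i].
  by case=> -[E1 E2]; move/negP: (fgG i); rewrite E1 E2 // adj_sym.
have B1 : (1 < #|~: A|)%N by lia.
split; first exact: (punctured_eigen_le f_inj g_inj fA gA Vn B1 sG e).
by move=> E; apply: (punctured_eigen_iso f_inj g_inj fA gA Vn B1 sG); rewrite -E.
Qed.

End Extremal.

Theorem theorem4p1 (R : realType) (n k : nat)
    (k_ge1 : (1 <= k)%N) (n_ge : (4 * k + 2 <= n)%N) :
  let a : R := (uphalf n)%:R in
  let b : R := (n./2)%:R in
  let c : R := a * b - 2 * k%:R + 1 in
  (forall (T : finType) (G : sgraph T),
     #|T| = n -> triangle_free G -> (k <= vconn (compl G))%N ->
     rho R G <= rho R (Bgraph n k) /\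
     (rho R G = rho R (Bgraph n k) <-> isomorphic G (Bgraph n k))) /\
  rho R (Bgraph n k) ^+ 2
    = (c + Num.sqrt (c ^+ 2 - 4 * (a - k%:R) * (b - k%:R))) / 2.
Proof.
move=> a b c; split; last by rewrite rho_Bgraph // mu_sqr.
move=> T G Tn tf kG.
have /(extremal_eigenvalue k_ge1 n_ge Tn tf kG)[le_mu eq_mu] :
    eigenvalue (adjmx R G) (rho R G) by apply: rho_eigenvalue; rewrite Tn; lia.
split; first by rewrite rho_Bgraph.
split; first by rewrite rho_Bgraph.
exact: isomorphic_rho.
Qed.
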